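(* A morphism $i \colon H \to K$ in $\mathbf{Hilb}$ is a partial isometry if and only if it is of the form $i = v \circ \ell^2 f \circ u$ for some morphism $f \colon X \to Y$ in $\mathbf{PInj}$ and unitaries $u \colon H \to \ell^2(X)$ and $v \colon \ell^2(Y) \to K$.
   Context: $\mathbf{Hilb}$ is the category whose objects are complex Hilbert spaces and whose morphisms are continuous linear functions; $f^\dag$ denotes the adjoint of a morphism $f$. A morphism $i$ of $\mathbf{Hilb}$ is a partial isometry when $i i^\dag i = i$. A unitary is an isomorphism $u$ with $u^{-1} = u^\dag$. $\mathbf{PInj}$ is the category whose objects are sets and whose morphisms $X \to Y$ are partial injections, i.e. partial functions that are injective on their domain of definition, composed as relations. The functor $\ell^2 \colon \mathbf{PInj} \to \mathbf{Hilb}$ sends a set $X$ to $\ell^2(X) = \{\varphi \colon X \to \mathbb{C} \mid \sum_{x\in X} |\varphi(x)|^2 < \infty\}$ with inner product $\langle \varphi | \psi\rangle = \sum_{x \in X} \overline{\varphi(x)}\psi(x)$, and sends a partial injection $f \colon X \to Y$ to the linear map $\ell^2 f \colon \ell^2(X) \to \ell^2(Y)$ with $(\ell^2 f)(\varphi)(y) = \varphi(x)$ if there is a (necessarily unique) $x$ in the domain of definition of $f$ with $f(x) = y$, and $(\ell^2 f)(\varphi)(y) = 0$ otherwise. *)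

(* Defs.v *)
From HB Require Import structures.
From mathcomp Require Import all_boot all_order all_algebra finmap.
From mathcomp Require Import sesquilinear complex.
From mathcomp Require Import boolp classical_sets functions cardinality fsbigop.
From mathcomp Require Import reals ereal esum.
From mathcomp Require Import ring lra.
From mathcomp Require Import topology normedtype summability.

Set Implicit Arguments.
Unset Strict Implicit.
Unset Printing Implicit Defensive.

Import Order.TTheory GRing.Theory Num.Theory.
Import numFieldNormedType.Exports.
Import Normc.

Local Open Scope classical_set_scope.
Local Open Scope complex_scope.
Local Open Scope ring_scope.

(* [{dot H for Num.conj}] is linear in its first argument and conjugate-linear
   in the second: [dotp y x] is the bracket <x|y> that is conjugate-linear in
   x.  [dotpE] makes the norm, hence the (complete) topology, the one induced
   by the inner product. *)
HB.mixin Record CompleteNormedModule_isHilbert (R : realType) H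
    & CompleteNormedModule R[i] H := {
  dotp : {dot H for Num.conj};
  dotpE : forall x : H, dotp x x = `|x| ^+ 2
}.

#[short(type="hilbertType")]
HB.structure Definition Hilbert (R : realType) :=
  {H of CompleteNormedModule R[i] H & CompleteNormedModule_isHilbert R H}.

#[local] Existing Instance totally_filter.

Section DotForms.
Context {C : numClosedFieldType} {U : lmodType C} (form : {dot U for Num.conj}).
Implicit Types u v : U.

Lemma dot_cauchy_schwarz u v : `|form u v| ^+ 2 <= form u u * form v v.
Proof.
have [->|v0] := eqVneq v 0; first by rewrite !linear0r normr0 expr0n mulr0.
have vv0 : form v v != 0 by rewrite gt_eqF// neq0_dnorm_gt0.
pose a := form u v / form v v; pose u1 := u - a *: v.
have ou : form u1 v = 0.
  by rewrite linearBl/= linearZl_LR/= divfK ?subrr.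
have -> : form u u = form u1 u1 + `|a| ^+ 2 * form v v.
  by rewrite -dnormZ -hnormDd ?subrK// linearZr_LR/= ou; exact: mulr0.
rewrite mulrDl; apply: ler_wpDl; first by rewrite mulr_ge0.
rewrite /a normf_div (ger0_norm (dnorm_ge0 form v)) exprMn exprVn.
by rewrite -mulrA -expr2 divfK// expf_neq0.
Qed.

Lemma dot_triangle u v :
  sqrtC (form (u + v) (u + v)) <= sqrtC (form u u) + sqrtC (form v v).
Proof.
rewrite -(ler_sqr _) ?nnegrE ?addr_ge0 ?sqrtC_ge0//.
rewrite sqrrD !sqrtCK dnormD [leRHS]addrAC; apply: lerD => //.
have -> : form u v + (form u v)^*%R = 'Re (form u v) *+ 2.
  by rewrite -mulr_natr ReE -mulrA mulVf ?mulr1// pnatr_eq0.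
rewrite lerMn2r/=; apply: (le_trans (leif_Re_Creal _) _).
rewrite -(ler_sqr _) ?nnegrE ?mulr_ge0 ?sqrtC_ge0//.
by rewrite exprMn !sqrtCK dot_cauchy_schwarz.
Qed.

End DotForms.

Section Sums.
Context {R : realType} {X : choiceType}.
Implicit Types (g : X -> R) (A : {fset X}).

Lemma partial_sumE (V : zmodType) (f : X -> V) A :
  partial_sum f A = \sum_(x <- A) f x.
Proof. by rewrite /partial_sum big_seq_fsetE. Qed.

Lemma sqr_normcC (z : R[i]) : (normc z ^+ 2)%:C = z * z^*%R.
Proof. by rewrite rmorphXn/= -normCK. Qed.

Lemma esum_bounded g : (forall x, 0 <= g x) ->
  (\esum_(x in [set: X]) (g x)%:E < +oo)%E <->
  exists M, forall A, \sum_(x <- A) g x <= M.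
Proof.
move=> g0; split=> [|[M gM]].
  have S0 : (0 <= \esum_(x in [set: X]) (g x)%:E)%E.
    by apply: esum_ge0 => x _; rewrite lee_fin.
  move=> Soo; have Sfin : \esum_(x in [set: X]) (g x)%:E \is a fin_num.
    by rewrite ge0_fin_numE.
  exists (fine (\esum_(x in [set: X]) (g x)%:E)) => A.
  rewrite -lee_fin fineK// -sumEFin; apply: ereal_sup_ubound.
  exists [set` A]; first by split.
  by rewrite fsbig_finite//= set_fsetK.
apply: (@le_lt_trans _ _ M%:E); last exact: ltry.
apply: ub_ereal_sup => _ [F [finF _] <-].
by rewrite fsbig_finite//= sumEFin lee_fin.
Qed.

Lemma ler_sum_fset g A B : (forall x, 0 <= g x) -> (A `<=` B)%fset ->
  \sum_(x <- A) g x <= \sum_(x <- B) g x.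
Proof.
move=> g0 AB; 
rewrite (eq_big_seq (fun x => if x \in A then g x else 0)); last by move=> x ->.
rewrite (big_fset_incl _ AB)/=; last by move=> x _ /negbTE ->.
by apply: ler_sum => x _; case: ifP.
Qed.

Lemma nneg_sum_cvg g M : (forall x, 0 <= g x) ->
  (forall A, \sum_(x <- A) g x <= M) ->
  exists s : R, [/\ forall A, \sum_(x <- A) g x <= s,
    forall N, (forall A, \sum_(x <- A) g x <= N) -> s <= N &
    partial_sum (fun x => (g x)%:C : R[i]^o) @ totally --> (s%:C : R[i]^o)].
Proof.
move=> g0 gM; pose S := [set \sum_(x <- A) g x | A in [set: {fset X}]].
have supS : has_sup S.
  split; first by exists (\sum_(x <- fset0) g x), fset0.
  by exists M => _ [A _ <-].
have leS A : \sum_(x <- A) g x <= sup S.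
  by apply: ub_le_sup; [case: supS|exists A].
exists (sup S); split=> //.
  by move=> N gN; apply: ge_sup; [case: supS|move=> _ [A _ <-]].
apply/cvgrPdist_le => /= e e0.
have eE : e = (complex.Re e)%:C by rewrite RRe_real// gtr0_real.
have e'0 : 0 < complex.Re e by move: e0; rewrite eE ltcR.
have [_ [A _ <-] ltA] := sup_adherent e'0 supS.
exists A => // B /= AB.
rewrite partial_sumE -rmorph_sum -rmorphB/= eE.
have -> (r : R) : `|r%:C| = `|r|%:C.
  by rewrite normc_def/= expr0n addr0 sqrtr_sqr.
rewrite lecR ger0_norm ?subr_ge0// lerBlDr -lerBlDl ltW//.
rewrite (lt_le_trans ltA)//.
exact: ler_sum_fset.
Qed.

End Sums.

Section SquareSummable.
Context {R : realType} {X : choiceType}.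
Implicit Types phi psi : X -> R[i].

Definition square_summable phi :=
  (\esum_(x in [set: X]) (normc (phi x) ^+ 2)%:E < +oo)%E.

Lemma square_summableP phi : square_summable phi <->
  exists M, forall A : {fset X}, \sum_(x <- A) normc (phi x) ^+ 2 <= M.
Proof. by apply: esum_bounded => x; exact: sqr_ge0. Qed.

Lemma square_summable0 : square_summable 0.
Proof.
apply/square_summableP; exists 0 => A; rewrite big1// => x _.
by rewrite [(0 : X -> R[i]) x]/(0 : R[i]) normc0 expr0n.
Qed.

Lemma normc_ge0 (z : R[i]) : 0 <= normc z.
Proof. by rewrite -ler0c; exact: (normr_ge0 z). Qed.

Lemma square_summableD phi psi : square_summable phi -> square_summable psi ->
  square_summable (phi + psi).
Proof.
move=> /square_summableP[M phiM] /square_summableP[N psiN].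
apply/square_summableP; exists (M *+ 2 + N *+ 2) => A.
apply: (@le_trans _ _
    (\sum_(x <- A) (normc (phi x) ^+ 2 *+ 2 + normc (psi x) ^+ 2 *+ 2))).
  apply: ler_sum => x _; rewrite [(phi + psi) x]/(phi x + psi x).
  set a := normc (phi x); set b := normc (psi x).
  apply: (@le_trans _ _ ((a + b) ^+ 2)).
    by rewrite ler_sqr ?nnegrE ?addr_ge0 ?normc_ge0// le_normcD.
  rewrite -subr_ge0 (_ : _ - _ = (a - b) ^+ 2) ?sqr_ge0//.
  by rewrite sqrrD sqrrB !mulr2n; ring.
by rewrite big_split/= !sumrMnl lerD// lerMn2r/=.
Qed.

Lemma square_summableZ (c : R[i]) phi :
  square_summable phi -> square_summable (c *: phi).
Proof.
move=> /square_summableP[M phiM].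
apply/square_summableP; exists (normc c ^+ 2 * M) => A.
rewrite (eq_bigr (fun x => normc c ^+ 2 * normc (phi x) ^+ 2)); last first.
  by move=> x _; rewrite [(c *: phi) x]/(c * phi x) normcM exprMn.
by rewrite -mulr_sumr ler_wpM2l// sqr_ge0.
Qed.

Definition square_summable_pred : {pred X -> R[i]} :=
  fun phi => `[< square_summable phi >].

End SquareSummable.

(* Classically every type is a [choiceType] (see [{classic T}]), so X is an
   arbitrary set. *)
Record l2 (R : realType) (X : choiceType) := L2 {
  l2fun :> X -> R[i];
  l2P : square_summable_pred l2fun }.

Section L2Module.
Context (R : realType) (X : choiceType).

HB.instance Definition _ := [isSub of l2 R X for @l2fun R X].
HB.instance Definition _ := [Choice of l2 R X by <:].

Lemma l2_submod_closed :
  submod_closed (@square_summable_pred R X).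
Proof.
split; first exact/asboolP/square_summable0.
move=> c phi psi /asboolP phi2 /asboolP psi2; apply/asboolP.
exact/square_summableD/psi2/square_summableZ.
Qed.

HB.instance Definition _ :=
  GRing.isSubmodClosed.Build R[i] (X -> R[i])
    (@square_summable_pred R X) l2_submod_closed.
HB.instance Definition _ := [SubChoice_isSubLmodule of l2 R X by <:].

Lemma l2_ext (phi psi : l2 R X) : phi =1 psi -> phi = psi.
Proof. by move=> e; apply/val_inj/funext. Qed.

Lemma l2DE (phi psi : l2 R X) x : (phi + psi) x = phi x + psi x.
Proof. by []. Qed.

Lemma l2ZE c (phi : l2 R X) x : (c *: phi) x = c * phi x.
Proof. by []. Qed.

Lemma l2BE (phi psi : l2 R X) x : (phi - psi) x = phi x - psi x.
Proof. by []. Qed.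

End L2Module.

Lemma polarization (C : numClosedFieldType) (z w : C) : z * w^* =
    (4%:R^-1 * 'i ^+ 0) * ((z + 'i ^+ 0 * w) * (z + 'i ^+ 0 * w)^*)
  + (4%:R^-1 * 'i ^+ 1) * ((z + 'i ^+ 1 * w) * (z + 'i ^+ 1 * w)^*)
  + (4%:R^-1 * 'i ^+ 2) * ((z + 'i ^+ 2 * w) * (z + 'i ^+ 2 * w)^*)
  + (4%:R^-1 * 'i ^+ 3) * ((z + 'i ^+ 3 * w) * (z + 'i ^+ 3 * w)^*).
Proof.
have i2 : 'i * 'i = -1 :> C by rewrite -expr2 sqrCi.
rewrite !rmorphD !rmorphM/= !rmorphXn/= conjCi.
move: ('i : C) (z^*) (w^*) i2 => i a b i2.
apply: (@mulfI _ 4%:R); first by rewrite pnatr_eq0.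
rewrite !mulrDr !mulrA divff ?pnatr_eq0// !mul1r.
have i2' : i ^+ 2 = -1 by [].
have i3 : i ^+ 3 = - i by rewrite exprS i2' mulrN1.
rewrite !expr0 !expr1 i3 i2'.
by ring: i2.
Qed.

Section L2Dot.
Context (R : realType) (X : choiceType).
Implicit Types phi psi chi : l2 R X.

(* [sum] is the limit of the net of sums over finite subsets of X, which exists
   by [l2dot_cvg]; in the convention of [dotp], this is <phi|psi>. *)
Definition l2dot psi phi : R[i] :=
  sum (fun x => psi x * (phi x)^*%R : R[i]^o).

Lemma l2sqrn_cvg phi : exists s : R, [/\
  forall A : {fset X}, \sum_(x <- A) normc (phi x) ^+ 2 <= s,
  forall N, (forall A : {fset X}, \sum_(x <- A) normc (phi x) ^+ 2 <= N) ->
    s <= N &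
  partial_sum (fun x => phi x * (phi x)^*%R : R[i]^o) @ totally
    --> (s%:C : R[i]^o)].
Proof.
have /asboolP/square_summableP[M phiM] := l2P phi.
have [s [leS lub cvgS]] :=
  nneg_sum_cvg (fun x => sqr_ge0 (normc (phi x))) phiM.
exists s; split => //.
rewrite (_ : (fun x => _ : R[i]^o) = fun x => (normc (phi x) ^+ 2)%:C) //.
by apply/funext => x; rewrite sqr_normcC.
Qed.

Lemma l2dot_cvg psi phi :
  partial_sum (fun x => psi x * (phi x)^*%R : R[i]^o) @ totally
    --> (l2dot psi phi : R[i]^o).
Proof.
suff : cvg (partial_sum (fun x => psi x * (phi x)^*%R : R[i]^o) @ totally).
  by [].
pose c k : R[i] := 4%:R^-1 * 'i ^+ k.
pose f k x : R[i]^o :=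
  (psi + 'i ^+ k *: phi) x * ((psi + 'i ^+ k *: phi) x)^*%R.
have fE : partial_sum (fun x => psi x * (phi x)^*%R : R[i]^o) =
    c 0 *: partial_sum (f 0) + c 1 *: partial_sum (f 1)
    + c 2 *: partial_sum (f 2) + c 3 *: partial_sum (f 3).
  apply/funext => A; rewrite !fctE !partial_sumE !scaler_sumr -!big_split/=.
  apply: eq_bigr => x _; rewrite /f /c !l2DE !l2ZE.
  exact: polarization.
have f_cvg k : cvg (partial_sum (f k) @ totally).
  have [s [_ _ cs]] := l2sqrn_cvg (psi + 'i ^+ k *: phi).
  by apply/cvg_ex; exists (s%:C : R[i]^o).
rewrite fE; apply: is_cvgD; first apply: is_cvgD; first apply: is_cvgD.
all: exact: is_cvgZr.
Qed.
End L2Dot.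
Arguments l2dot {R X} psi phi.

Section L2Hermitian.
Context (R : realType) (X : choiceType).
Implicit Types phi psi chi : l2 R X.

Lemma l2dot_unique psi phi (l : R[i]) :
  partial_sum (fun x => psi x * (phi x)^*%R : R[i]^o) @ totally
    --> (l : R[i]^o) -> l2dot psi phi = l.
Proof.
move=> cvl; have := l2dot_cvg (psi:=psi) (phi:=phi) => cv.
exact: (cvg_unique _ cv cvl).
Qed.

Lemma l2dot_linearl phi : scalar (l2dot ^~ phi).
Proof.
move=> a u v; apply: l2dot_unique.
rewrite (_ : partial_sum _ =
      a *: partial_sum (fun x => u x * (phi x)^*%R : R[i]^o)
    + partial_sum (fun x => v x * (phi x)^*%R : R[i]^o)).
  by apply: cvgD; [apply: cvgZr; exact: l2dot_cvg|exact: l2dot_cvg].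
apply/funext => A; rewrite !fctE !partial_sumE !scaler_sumr -!big_split.
by apply: eq_bigr => x _; rewrite l2DE l2ZE mulrDl -mulrA.
Qed.

Lemma l2dotC psi phi : l2dot psi phi = (l2dot phi psi)^*%R.
Proof.
apply: l2dot_unique; apply/cvgrPdist_lt => e e0.
have /cvgrPdist_lt/(_ e e0) := @l2dot_cvg R X phi psi.
apply: filterS => A; rewrite -(norm_conjC (_ - _)) rmorphB/=.
set p := partial_sum _ _; set q := partial_sum _ _.
suff -> : p^*%R = q by [].
rewrite /p /q !partial_sumE rmorph_sum; apply: eq_bigr => x _.
by rewrite rmorphM/= conjCK mulrC.
Qed.

Lemma l2dot_linearr psi : linear_for (Num.conj \; *%R) (l2dot psi).
Proof.
move=> a u v /=; rewrite l2dotC l2dot_linearl rmorphD rmorphM/=.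
by rewrite -!l2dotC.
Qed.

HB.instance Definition _ := bilinear_isBilinear.Build R[i] (l2 R X) (l2 R X)
  R[i] *%R (Num.conj \; *%R) (@l2dot R X) (l2dot_linearl, l2dot_linearr).

Lemma l2dot_hermitian psi phi :
  l2dot psi phi = (-1) ^+ false * Num.conj (l2dot phi psi).
Proof. by rewrite mul1r -l2dotC. Qed.

HB.instance Definition _ := isHermitianSesquilinear.Build R[i] (l2 R X) false
  Num.conj (@l2dot R X) l2dot_hermitian.

Lemma l2dot_sup phi : exists s : R, [/\
  forall A : {fset X}, \sum_(x <- A) normc (phi x) ^+ 2 <= s,
  forall N, (forall A : {fset X}, \sum_(x <- A) normc (phi x) ^+ 2 <= N) ->
    s <= N & l2dot phi phi = s%:C].
Proof.
have [s [leS lub cs]] := l2sqrn_cvg phi.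
by exists s; split=> //; exact: l2dot_unique.
Qed.

Lemma l2dot_gt0 phi : phi != 0 -> 0 < l2dot phi phi.
Proof.
move=> phi0; have [x phix0] : exists x, phi x != 0.
  apply: contrapT => /forallNP phi0'; move/eqP: phi0; apply.
  by apply: l2_ext => x; apply/eqP/negP => /negP; exact: phi0'.
have [s [leS _ ->]] := l2dot_sup phi; rewrite ltcR.
apply: lt_le_trans (leS [fset x]%fset); rewrite big_seq_fset1 exprn_gt0//.
by rewrite -ltcR; change (0 < `|phi x|); rewrite normr_gt0.
Qed.

HB.instance Definition _ :=
  isDotProduct.Build R[i] (l2 R X) (@l2dot R X) l2dot_gt0.

Definition l2norm phi : R[i] := sqrtC (l2dot phi phi).

Lemma l2normD phi psi : l2norm (phi + psi) <= l2norm phi + l2norm psi.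
Proof. exact: (@dot_triangle R[i] (l2 R X) l2dot). Qed.

Lemma l2normZ c phi : l2norm (c *: phi) = `|c| * l2norm phi.
Proof.
rewrite /l2norm (@dnormZ R[i] (l2 R X) l2dot) sqrtCM ?nnegrE ?exprn_ge0//.
by rewrite sqrCK.
Qed.

Lemma l2norm_eq0 phi : l2norm phi = 0 -> phi = 0.
Proof.
move=> /eqP; rewrite sqrtC_eq0 (@dnorm_eq0 R[i] (l2 R X) l2dot).
by move/eqP.
Qed.

HB.instance Definition _ :=
  Lmodule_isNormed.Build R[i] (l2 R X) l2normD l2normZ l2norm_eq0.

Lemma l2dotE phi : l2dot phi phi = `|phi| ^+ 2.
Proof. by have -> : `|phi| = l2norm phi by []; rewrite sqrtCK. Qed.

End L2Hermitian.

Section L2Complete.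
Context (R : realType) (X : choiceType).
Implicit Types phi psi : l2 R X.

Lemma l2norm_coord phi (A : {fset X}) (e : R) : `|phi| <= e%:C ->
  \sum_(x <- A) normc (phi x) ^+ 2 <= e ^+ 2.
Proof.
move=> phie; have [s [leS _ sE]] := l2dot_sup phi.
apply: (le_trans (leS A)); rewrite -lecR -sE l2dotE rmorphXn/=.
by rewrite lerXn2r// nnegrE// (le_trans _ phie).
Qed.

Lemma l2norm_bound phi (e : R) : 0 <= e ->
  (forall A : {fset X}, \sum_(x <- A) normc (phi x) ^+ 2 <= e ^+ 2) ->
  `|phi| <= e%:C.
Proof.
move=> e0 phie; have [s [_ lub sE]] := l2dot_sup phi.
rewrite -ler_sqr ?nnegrE ?ler0c// -l2dotE sE -rmorphXn lecR; exact: lub.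
Qed.

Lemma normc_sq (z : R[i]) :
  normc z ^+ 2 = complex.Re z ^+ 2 + complex.Im z ^+ 2.
Proof. by case: z => a b; rewrite sqr_sqrtr// addr_ge0 ?sqr_ge0. Qed.

Lemma l2norm_coord1 phi (x : X) (e : R) : 0 <= e -> `|phi| <= e%:C ->
  `|complex.Re (phi x)| <= e /\ `|complex.Im (phi x)| <= e.
Proof.
move=> e0 /(l2norm_coord [fset x]%fset); rewrite big_seq_fset1 normc_sq => h.
have sq2 (a b : R) : a ^+ 2 + b ^+ 2 <= e ^+ 2 -> `|a| <= e.
  move=> abe; rewrite -ler_sqr ?nnegrE// -normrX ger0_norm ?sqr_ge0//.
  by apply: le_trans abe; rewrite lerDl sqr_ge0.
by split; [exact: sq2 h|apply: (sq2 _ (complex.Re (phi x))); rewrite addrC].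
Qed.

Lemma l2_complete (F : set_system (l2 R X)) :
  ProperFilter F -> cauchy F -> cvg F.
Proof.
move=> FF /cauchy_ballP Fc.
have Fe (e : R) : 0 < e ->
    exists2 P, F P & forall phi psi, P phi -> P psi -> `|phi - psi| <= e%:C.
  move=> e0; have eC : 0 < e%:C by rewrite ltcR.
  have [[P Q] [/= FP FQ] PQ] := Fc _ eC.
  exists (P `&` Q); first exact: filterI.
  move=> phi psi [Pphi _] [_ Qpsi]; have := PQ (phi, psi) (conj Pphi Qpsi).
  by rewrite /= -ball_normE /= => /ltW.
have coord_cauchy (h : R[i] -> R) x :
    (forall phi psi e, 0 <= e -> `|phi - psi| <= e%:C ->
       `|h (phi x) - h (psi x)| <= e) ->
    cvg (h (phi x) @[phi --> F]).
  move=> he; apply: cauchy_cvg; apply/cauchy_ballP => e e0.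
  have e20 : 0 < e / 2 by rewrite divr_gt0.
  have [P FP Pe] := Fe _ e20.
  pose Q : set R := [set h (phi x) | phi in P].
  have FQ : F [set phi | Q (h (phi x))].
    by apply: filterS FP => phi Pphi; exists phi.
  exists (Q, Q) => //.
  move=> [_ _] /= [[phi Pphi <-] [psi Ppsi <-]].
  rewrite -ball_normE /=; apply: (@le_lt_trans _ _ (e / 2)).
    by apply: he; [exact: ltW|exact: Pe].
  by rewrite ltr_pdivrMr// ltr_pMr// ltr1n.
have Re_cvg x : cvg (complex.Re (phi x) @[phi --> F]).
  apply: coord_cauchy => phi psi e e0 /(l2norm_coord1 x e0)[+ _].
  by rewrite l2BE raddfB.
have Im_cvg x : cvg (complex.Im (phi x) @[phi --> F]).
  apply: coord_cauchy => phi psi e e0 /(l2norm_coord1 x e0)[_].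
  by rewrite l2BE raddfB.
pose l x : R[i] := Complex (lim (complex.Re (phi x) @[phi --> F]))
                           (lim (complex.Im (phi x) @[phi --> F])).
have l_close P e phi : 0 <= e -> F P ->
    (forall phi psi, P phi -> P psi -> `|phi - psi| <= e%:C) -> P phi ->
    forall A : {fset X}, \sum_(x <- A) normc (phi x - l x) ^+ 2 <= e ^+ 2.
  move=> e0 FP Pe Pphi A.
  pose u psi : R := \sum_(x <- A) normc (phi x - psi x) ^+ 2.
  apply: (@closed_cvg _ _ F _ u (fun y => y <= e ^+ 2)).
  - exact: closed_le.
  - apply: filterS FP => psi Ppsi.
    exact: (l2norm_coord A (Pe _ _ Pphi Ppsi)).
  - rewrite /u; apply: cvg_big => [|x _]; first exact: add_continuous.
    rewrite normc_sq !raddfB/=.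
    under eq_fun do rewrite normc_sq !raddfB/=.
    by apply: cvgD; rewrite expr2; under eq_fun do rewrite expr2;
      apply: cvgM; (apply: cvgB; [exact: cvg_cst|]);
      [exact: Re_cvg|exact: Re_cvg|exact: Im_cvg|exact: Im_cvg].
have l2l : square_summable_pred l.
  have [P FP Pe] := Fe 1 ltr01; have [phi Pphi] := filter_ex FP.
  have d2 : square_summable ((phi : X -> R[i]) - l).
    apply/square_summableP; exists (1 ^+ 2) => A.
    exact: (l_close _ _ _ ler01 FP Pe Pphi).
  apply/asboolP.
  rewrite (_ : l = (phi : X -> R[i]) + (-1) *: ((phi : X -> R[i]) - l)).
    by apply: square_summableD; [exact/asboolP/l2P|exact: square_summableZ].
  by rewrite scaleN1r opprB addrC subrK.
apply/cvg_ex; exists (L2 l2l); apply/cvgrPdist_le => /= e e0.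
have eE : e = (complex.Re e)%:C by rewrite RRe_real// gtr0_real.
have e'0 : 0 < complex.Re e by move: e0; rewrite eE ltcR.
have [P FP Pe] := Fe _ e'0; apply: filterS (FP) => phi Pphi.
rewrite distrC eE; apply: l2norm_bound; first exact: ltW.
exact: (l_close _ _ _ (ltW e'0) FP Pe Pphi).
Qed.

HB.instance Definition _ := Uniform_isComplete.Build (l2 R X) l2_complete.

HB.instance Definition _ :=
  CompleteNormedModule_isHilbert.Build R (l2 R X) (@l2dotE R X).

Lemma l2_dotpE psi phi :
  dotp psi phi = sum (fun x => psi x * (phi x)^*%R : R[i]^o).
Proof. by []. Qed.

End L2Complete.

(* The morphisms of Hilb: continuous linear maps. *)
HB.structure Definition HilbMorphism (R : realType) (H K : hilbertType R) :=
  {f of @GRing.Linear R[i] H K *:%R f & @isContinuous H K f}.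

Notation "{ 'hilb' H -> K }" := (HilbMorphism.type H%type K%type)
  (H at level 98, K at level 99, format "{ 'hilb'  H  ->  K }") : type_scope.

Section Riesz.
Context {R : realType} {H : hilbertType R}.
Implicit Types x y z h : H.

Lemma parallelogram x y :
  `|x + y| ^+ 2 + `|x - y| ^+ 2 = (`|x| ^+ 2 + `|y| ^+ 2) *+ 2.
Proof. by rewrite -!dotpE dnormD dnormB addrACA subrr addr0 -mulr2n. Qed.

Lemma dotp_bound x y : `|dotp x y| <= `|x| * `|y|.
Proof.
by rewrite -ler_sqr ?nnegrE ?mulr_ge0// exprMn -!dotpE dot_cauchy_schwarz.
Qed.

Definition rnorm x : R := complex.Re `|x|.

Lemma rnormE x : `|x| = (rnorm x)%:C.
Proof. by rewrite /rnorm RRe_real// ger0_real. Qed.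

Lemma rnorm_ge0 x : 0 <= rnorm x.
Proof. by rewrite -ler0c -rnormE. Qed.

Lemma rnormD x y : rnorm (x + y) <= rnorm x + rnorm y.
Proof. by rewrite -lecR rmorphD/= -!rnormE ler_normD. Qed.

Lemma rnormZ (k : R[i]) x : rnorm (k *: x) = normc k * rnorm x.
Proof. by apply: complexI; rewrite rmorphM/= -!rnormE normrZ. Qed.

Lemma rnorm_parallelogram x y :
  rnorm (x + y) ^+ 2 + rnorm (x - y) ^+ 2 =
  (rnorm x ^+ 2 + rnorm y ^+ 2) *+ 2.
Proof.
apply: complexI; rewrite !(rmorphD, rmorphMn, rmorphXn)/= -!rnormE.
exact: parallelogram.
Qed.

Lemma min_rnorm (l : H -> R[i]) (M : R) : scalar l ->
  (forall x, `|l x| <= M%:C * `|x|) -> (exists x, l x = 1) ->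
  exists2 z, l z = 1 & forall x, l x = 1 -> rnorm z <= rnorm x.
Proof.
move=> lin lM [x1 lx1].
have lB x y : l (x - y) = l x - l y.
  by rewrite addrC -scaleN1r lin mulN1r addrC.
have lD x y : l (x + y) = l x + l y by have := lin 1 x y; rewrite scale1r mul1r.
have l0 : l 0 = 0 by rewrite -(subrr x1) lB subrr.
have lZ a x : l (a *: x) = a * l x.
    by have := lin a x 0; rewrite !addr0 l0 addr0.
pose D := [set rnorm x | x in [set x | l x = 1]].
have infD : has_inf D.
  by split; [exists (rnorm x1), x1|exists 0 => _ [x _ <-]; exact: rnorm_ge0].
pose d := inf D.
have d0 : 0 <= d.
  by apply: lb_le_inf; [case: infD|move=> _ [x _ <-]; exact: rnorm_ge0].
have dS x : l x = 1 -> d <= rnorm x.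
  by move=> lx; apply: ge_inf; [case: infD|exists x].
pose B e := [set x | l x = 1 /\ rnorm x < d + e].
have B0 e : 0 < e -> B e !=set0.
  by move=> e0; have [_ [x lx <-] xe] := inf_adherent e0 infD; exists x.
pose G := filter_from [set e : R | 0 < e] B.
have GF : ProperFilter G.
  apply: filter_from_proper => //; apply: filter_from_filter.
    by exists 1; rewrite /= ltr01.
  move=> e f /= e0 f0; exists (Num.min e f); first by rewrite /= lt_min e0.
  move=> x [lx]; rewrite -ltrBlDl lt_min => /andP[xe xf].
  by split; split => //; rewrite -ltrBlDl.
have mid x y : l x = 1 -> l y = 1 -> d *+ 2 <= rnorm (x + y).
  move=> lx ly; have := dS (2%:R^-1 *: (x + y)).
  rewrite lZ lD lx ly -[1 + 1]/(2%:R) mulVf ?pnatr_eq0// => /(_ erefl).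
  rewrite rnormZ.
  have -> : normc (2%:R^-1 : R[i]) = 2%:R^-1.
    apply: complexI; change (`|2%:R^-1 : R[i]| = (2%:R^-1)%:C).
    by rewrite ger0_norm ?invr_ge0 ?ler0n// fmorphV rmorph_nat.
  by rewrite mulrC ler_pdivlMr// mulr_natr.
have GB e x y : 0 < e -> e <= 1 -> B e x -> B e y ->
    rnorm (x - y) ^+ 2 < (8 * d + 8) * e.
  move=> e0 e1 [lx xe] [ly ye]; have xy := mid _ _ lx ly.
  have := rnorm_parallelogram x y; have := rnorm_ge0 x; have := rnorm_ge0 y.
  have := dS _ lx; have := dS _ ly; move: xy xe ye.
  move: (rnorm x) (rnorm y) (rnorm (x + y)) (rnorm (x - y)) => a b c r.
  rewrite !mulr2n => *.
  have : a ^+ 2 <= (d + e) ^+ 2 by rewrite ler_sqr ?nnegrE; lra.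
  have : b ^+ 2 <= (d + e) ^+ 2 by rewrite ler_sqr ?nnegrE; lra.
  have : (d + d) ^+ 2 <= c ^+ 2 by rewrite ler_sqr ?nnegrE; lra.
  by nra.
have Gc : cauchy G.
  apply/cauchy_ballP => e e0.
  have eE : e = (complex.Re e)%:C by rewrite RRe_real// gtr0_real.
  have e'0 : 0 < complex.Re e by move: e0; rewrite eE ltcR.
  pose e1 := Num.min 1 (complex.Re e ^+ 2 / (8 * d + 8)).
  have d8 : 0 < 8 * d + 8 by lra.
  have e10 : 0 < e1 by rewrite lt_min ltr01 divr_gt0// exprn_gt0.
  have GBe : G (B e1) by exists e1.
  exists (B e1, B e1) => // -[x y] [/= Bx By].
  rewrite -ball_normE/= rnormE eE ltcR.
  rewrite -ltr_sqr ?nnegrE ?rnorm_ge0 ?(ltW e'0)//.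
  apply: (lt_le_trans (GB e1 x y e10 _ Bx By)); first by rewrite ge_min lexx.
  by rewrite mulrC -ler_pdivlMr// ge_min lexx orbT.
have /cvg_ex[z Gz] : cvg G by exact: cauchy_cvg.
have Gz' e : 0 < e ->
    exists x, [/\ l x = 1, rnorm x < d + e & rnorm (z - x) < e].
  move=> e0; have eC : 0 < e%:C by rewrite ltcR.
  have /fcvgrPdist_lt/(_ _ eC) [f f0 fB] := Gz.
  have m0 : 0 < Num.min e f by rewrite lt_min e0.
  have [x [lx xm]] := B0 _ m0; exists x; split=> //.
    by apply: lt_le_trans xm _; rewrite lerD2l ge_min lexx.
  have /fB : B f x.
    by split => //; apply: lt_le_trans xm _; rewrite lerD2l ge_min lexx orbT.
  by rewrite /= rnormE ltcR.
exists z.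
  have M0 : 0 <= Num.max M 0 by rewrite le_max lexx orbT.
  have lM' x : `|l x| <= (Num.max M 0)%:C * `|x|.
    by apply: le_trans (lM x) _; rewrite ler_wpM2r// lecR le_max lexx.
  suff lz : normc (l z - 1) <= 0.
    apply/eqP; rewrite -subr_eq0; apply/eqP/eq0_normc.
    by apply/eqP; rewrite eq_le lz normc_ge0.
  apply/ler_addgt0Pr => e e0; rewrite add0r.
  have M1 : 0 < Num.max M 0 + 1 by rewrite ltr_wpDl.
  have [x [lx _ zx]] := Gz' _ (divr_gt0 e0 M1).
  rewrite -lx -lB -lecR; change (`|l (z - x)| <= e%:C).
  apply: (le_trans (lM' _)); rewrite rnormE -rmorphM lecR.
  move: zx; rewrite ltr_pdivlMr// => /ltW; apply: le_trans.
  by rewrite mulrC ler_wpM2l ?rnorm_ge0// lerDl.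
move=> x lx; apply: le_trans (dS _ lx).
apply/ler_addgt0Pr => e e0.
have [y [ly ye zy]] := Gz' _ (divr_gt0 e0 (ltr0Sn R 1)).
have := rnormD (z - y) y; rewrite subrK; lra.
Qed.

Lemma riesz_bounded (l : H -> R[i]) (M : R) : scalar l ->
  (forall x, `|l x| <= M%:C * `|x|) -> exists z, forall x, l x = dotp x z.
Proof.
move=> lin lM.
have [lx0|l_eq0] := pselect (exists x, l x != 0); last first.
  exists 0 => x; rewrite linear0r; apply/eqP/negP => /negP lx.
  by apply: l_eq0; exists x.
have l0 : l 0 = 0.
  by have := lin (-1) 0 0; rewrite scaler0 addr0 mulN1r addNr.
have lZ a x : l (a *: x) = a * l x.
    by have := lin a x 0; rewrite !addr0 l0 addr0.
have [z lz zmin] : exists2 z, l z = 1 & forall x, l x = 1 -> rnorm z <= rnorm x.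
  apply: (min_rnorm lin lM); have [x lx] := lx0.
  by exists ((l x)^-1 *: x); rewrite lZ mulVf.
have orth h : l h = 0 -> dotp h z = 0.
  move=> lh; have [->|h0] := eqVneq h 0; first by rewrite linear0l.
  have hh0 : dotp h h != 0 by rewrite gt_eqF// neq0_dnorm_gt0.
  pose a := dotp z h / dotp h h; pose u := z - a *: h.
  have lu : l u = 1.
    by rewrite /u addrC -scaleNr lin lh mulr0 add0r.
  have uh : dotp u h = 0 by rewrite linearBl/= linearZl_LR/= divfK ?subrr.
  have zE : dotp z z = dotp u u + `|a| ^+ 2 * dotp h h.
    by rewrite -dnormZ -hnormDd ?subrK// linearZr_LR/= uh; exact: mulr0.
  have : dotp z z <= dotp u u.
    by rewrite !dotpE ler_sqr ?nnegrE// !rnormE lecR zmin.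
  rewrite zE gerDl => ah; have : `|a| ^+ 2 * dotp h h == 0.
    by rewrite eq_le ah mulr_ge0 ?exprn_ge0.
  rewrite mulf_eq0 (negbTE hh0) orbF expf_eq0/= normr_eq0 mulf_eq0 invr_eq0.
  rewrite (negbTE hh0) orbF => /eqP zh.
  have -> : dotp h z = (-1) ^+ false * Num.conj (dotp z h) by exact: hermC.
  by rewrite zh conjC0 mulr0.
have zz0 : dotp z z != 0.
  rewrite dnorm_eq0; apply: contra_eqN lz => /eqP ->.
  by rewrite l0 eq_sym oner_eq0.
exists ((dotp z z)^-1 *: z) => x.
rewrite linearZr_LR/= fmorphV/= geC0_conj//.
have : dotp (x - l x *: z) z = 0.
  by apply: orth; rewrite addrC -scaleNr lin lz mulr1 addNr.
rewrite linearBl/= linearZl_LR/= => /eqP; rewrite subr_eq0 => /eqP ->.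
by rewrite mulrC mulfK.
Qed.

Lemma dotp_ext x y : (forall z, dotp z x = dotp z y) -> x = y.
Proof.
move=> e; apply/eqP; rewrite -subr_eq0 -(dnorm_eq0 dotp).
by rewrite linearBr/= e subrr.
Qed.

End Riesz.

Section Adjoint.
Context {R : realType} {H K : hilbertType R} (f : {hilb H -> K}).

Lemma hilb_bounded : exists M : R, 0 < M /\ forall x, `|f x| <= M%:C * `|x|.
Proof.
have /linear_boundedP : bounded_near f (nbhs (0 : H)).
  by apply/linear_bounded_continuous; exact: cts_fun.
move=> /pinfty_ex_gt0[r r0 fr]; have rE : r = (complex.Re r)%:C.
  by rewrite RRe_real// gtr0_real.
exists (complex.Re r); rewrite -rE; split => //.
by rewrite -ltcR -rE.
Qed.

Lemma adjoint_ex (y : K) : exists z : H, forall x, dotp (f x) y = dotp x z.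
Proof.
have [M [M0 fM]] := hilb_bounded.
apply: (@riesz_bounded _ _ (fun x => dotp (f x) y) (M * rnorm y)).
  by move=> a u v; rewrite linearP linearDl/= linearZl_LR.
move=> x; apply: (le_trans (dotp_bound _ _)).
by rewrite rmorphM/= -rnormE mulrAC ler_wpM2r.
Qed.

(* The adjoint of f, obtained from the Riesz representation of each functional
   [fun x => dotp (f x) y]; see [adjointP] and [dotp_ext]. *)
Definition adjoint (y : K) : H := sval (cid (adjoint_ex y)).

Lemma adjointP x y : dotp (f x) y = dotp x (adjoint y).
Proof. by rewrite /adjoint; case: cid => z /= ->. Qed.

Lemma adjoint_linear : linear adjoint.
Proof.
move=> a u v; apply: dotp_ext => z.
by rewrite -adjointP !(linearDr, linearZr_LR)/= !adjointP.
Qed.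

HB.instance Definition _ :=
  GRing.isLinear.Build R[i] K H *:%R adjoint adjoint_linear.

Lemma adjoint_continuous : continuous adjoint.
Proof.
apply/linear_bounded_continuous/linear_boundedP.
have [M [M0 fM]] := hilb_bounded.
have M0' : 0 < M%:C by rewrite ltcR.
exists M%:C; split; first exact: gtr0_real.
move=> r Mr y; have [->|y0] := eqVneq (`|adjoint y|) 0.
  by rewrite mulr_ge0// ltW// (lt_trans M0').
apply: (@le_trans _ _ (M%:C * `|y|)); last by rewrite ler_wpM2r// ltW.
rewrite -(@ler_pM2l _ `|adjoint y|) ?lt_def ?y0//= -expr2 -dotpE -adjointP.
have := dotp_bound (f (adjoint y)) y.
rewrite ger0_norm; last by rewrite adjointP.
move=> /le_trans; apply.
by rewrite mulrA (mulrC _ M%:C) ler_wpM2r.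
Qed.

HB.instance Definition _ := isContinuous.Build K H adjoint adjoint_continuous.

End Adjoint.

Section PartialIsometry.
Context {R : realType} {H K : hilbertType R}.

Definition partial_isometry (f : {hilb H -> K}) :=
  f \o adjoint f \o f = f :> (H -> K).

Definition unitary (f : {hilb H -> K}) :=
  adjoint f \o f = id /\ f \o adjoint f = id.

End PartialIsometry.

(* The morphisms of PInj; undefined points are sent to [None]. *)
Record pinj (X Y : Type) := PInj {
  pinj_fun :> X -> option Y;
  pinj_inj : forall x x' y,
    pinj_fun x = Some y -> pinj_fun x' = Some y -> x = x' }.

Section L2Map.
Context {R : realType} {X Y : choiceType} (f : pinj X Y).
Implicit Types phi psi : l2 R X.

(* The converse relation of f, which is again a partial function. *)
Definition pinj_preim (y : Y) : option X :=
  if pselect (exists x, f x = Some y) is left fxy then Some (sval (cid fxy))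
  else None.

Lemma pinj_preimP x y : pinj_preim y = Some x <-> f x = Some y.
Proof.
rewrite /pinj_preim; case: pselect => [fxy|fxyN]; last first.
  by split=> // fxy; case: fxyN; exists x.
case: cid => x' /= fx'; split=> [[<-//]|fx].
by rewrite (pinj_inj fx' fx).
Qed.

Definition l2map_fun (phi : X -> R[i]) (y : Y) : R[i] :=
  if pinj_preim y is Some x then phi x else 0.

Lemma l2map_sum_le phi (M : R) (A : {fset Y}) :
  (forall B : {fset X}, \sum_(x <- B) normc (phi x) ^+ 2 <= M) ->
  \sum_(y <- A) normc (l2map_fun phi y) ^+ 2 <= M.
Proof.
move=> phiM; pose s := pmap pinj_preim A.
have s_uniq : uniq s.
  rewrite /s; elim: (enum_fset A) (fset_uniq A) => //= y t IH /andP[yt /IH ut].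
  case E: (pinj_preim y) => [x|//] /=; rewrite ut andbT.
  apply: contra yt; rewrite mem_pmap => /mapP[y' y't E'].
  have /pinj_preimP := E; have /esym/pinj_preimP -> := E'.
  by move=> [<-].
suff -> : \sum_(y <- A) normc (l2map_fun phi y) ^+ 2 =
          \sum_(x <- [fset x | x in s]%fset) normc (phi x) ^+ 2 by exact: phiM.
have -> : \sum_(x <- [fset x | x in s]%fset) normc (phi x) ^+ 2 =
          \sum_(x <- s) normc (phi x) ^+ 2.
  apply: perm_big; apply: uniq_perm => // x.
  by rewrite !inE.
rewrite /s; elim: (enum_fset A) => [|y t IH]; first by rewrite !big_nil.
rewrite big_cons IH [pmap _ (y :: t)]/= /l2map_fun.
by case: (pinj_preim y) => [x|]; rewrite ?big_cons// normc0 expr0n add0r.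
Qed.

Lemma l2map_square_summable phi : square_summable_pred (l2map_fun phi).
Proof.
have /asboolP/square_summableP[M phiM] := l2P phi.
by apply/asboolP/square_summableP; exists M => A; exact: l2map_sum_le.
Qed.

Definition l2map phi : l2 R Y := L2 (l2map_square_summable phi).

Lemma l2mapE phi x y : f x = Some y -> l2map phi y = phi x.
Proof. by move=> /pinj_preimP fxy; rewrite /= /l2map_fun fxy. Qed.

Lemma l2map_out phi y : (forall x, f x <> Some y) -> l2map phi y = 0.
Proof.
move=> fN; rewrite /= /l2map_fun; case E: pinj_preim => [x|//].
by have /pinj_preimP/fN := E.
Qed.

Lemma l2map_linear : linear l2map.
Proof.
move=> a phi psi; apply: l2_ext => y; rewrite l2DE l2ZE /= /l2map_fun.
by case: pinj_preim => [x|]; rewrite ?l2DE ?l2ZE// mulr0 addr0.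
Qed.

HB.instance Definition _ :=
  GRing.isLinear.Build R[i] (l2 R X) (l2 R Y) *:%R l2map l2map_linear.

Lemma l2map_norm_le phi : `|l2map phi| <= `|phi|.
Proof.
rewrite [leRHS]rnormE; apply: l2norm_bound; first exact: rnorm_ge0.
move=> A; apply: l2map_sum_le => B; apply: l2norm_coord.
by rewrite rnormE.
Qed.

Lemma l2map_continuous : continuous l2map.
Proof.
apply/linear_bounded_continuous/linear_boundedP.
exists 1; split; first exact: real1.
move=> r /ltW r1 phi; apply: (le_trans (l2map_norm_le phi)).
by rewrite ler_peMl.
Qed.

HB.instance Definition _ :=
  isContinuous.Build (l2 R X) (l2 R Y) l2map l2map_continuous.

End L2Map.

(* Main.v *)
Require Import Defs.
From mathcomp Require Import all_boot all_algebra complex.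
From mathcomp Require Import reals.
From HB Require Import structures.
From mathcomp Require Import all_order finmap sesquilinear.
From mathcomp Require Import boolp classical_sets functions.
From mathcomp Require Import topology normedtype summability.

Set Implicit Arguments.
Unset Strict Implicit.
Unset Printing Implicit Defensive.

Import Order.TTheory GRing.Theory Num.Theory.
Import numFieldNormedType.Exports.
Import Normc.

(** Two observations carry the proof.

    If f is a contraction and f g f = f for some contraction g, then f is a
    partial isometry ([partial_isometry_of_contractions]).  Indeed z = g (f x)
    satisfies f z = f x and |z| <= |f x| = |f z| <= |z|, and a contraction that
    preserves the norm of z has adjoint f (f z) = z ([adjoint_fixed]); hence
    f (adjoint f (f x)) = f z = f x.  For f = v o l2map h o u one takes for g
    the composite of the adjoints of v and u around l2map of the converse of
    h; in this way the adjoint of l2map h never has to be computed.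

    Conversely, let i be a partial isometry, and p = adjoint i o i, which is
    idempotent.  Zorn's lemma gives an orthonormal basis E of H each vector of
    which is killed by i or fixed by p ([adapted_basis]).  On the fixed vectors
    i preserves inner products, so the nonzero vectors i e are orthonormal and
    extend to an orthonormal basis F of K ([image_basis]).  Sending e to i e
    when i e <> 0 is then a partial injection from E to F.  An orthonormal
    basis makes H unitarily isomorphic to l2 through the coefficients
    x |-> (<e_k|x>)_k ([coefficients_unitary]), and comparing the coefficients
    of i x in F with those of x in E gives the factorization
    ([coefficients_match]).

    Sums over a basis are never formed: the inverse of the coefficient map is
    its adjoint, which the Riesz representation theorem already provides. *)

#[local] Existing Instance totally_filter.

(** * Inner products and adjoints *)

Section InnerProduct.
Local Open Scope ring_scope.
Context {R : realType} {H : hilbertType R}.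
Implicit Types x y : H.

Lemma dotpC x y : dotp x y = (dotp y x)^*%R.
Proof.
have -> : dotp x y = (-1) ^+ false * Num.conj (dotp y x) by exact: hermC.
by rewrite mul1r.
Qed.

Lemma dotp_eq0C x y : dotp x y = 0 -> dotp y x = 0.
Proof. by rewrite (dotpC y) => ->; rewrite conjC0. Qed.

Lemma ler_norm_dotp (K : hilbertType R) x (y : K) :
  (`|x| <= `|y|) = (dotp x x <= dotp y y).
Proof. by rewrite !dotpE ler_sqr ?nnegrE. Qed.

End InnerProduct.

Section Adjoint.
Local Open Scope ring_scope.
Context {R : realType} {H K : hilbertType R}.
Implicit Types (f : {hilb H -> K}) (x : H) (y : K).

Lemma adjoint_dotp f x y : dotp (adjoint f y) x = dotp y (f x).
Proof. by rewrite dotpC -adjointP -dotpC. Qed.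

Lemma adjointK f : adjoint (adjoint f) = f :> (H -> K).
Proof.
apply/funext => x; apply: dotp_ext => y.
by rewrite -adjointP adjoint_dotp.
Qed.

(** Cauchy-Schwarz bounds |adjoint f y|^2 = <y|f (adjoint f y)> by
    |f (adjoint f y)| |y|, and one factor |adjoint f y| cancels. *)
Lemma adjoint_contraction f : (forall x, `|f x| <= `|x|) ->
  forall y, `|adjoint f y| <= `|y|.
Proof.
move=> f1 y; have [->|y0] := eqVneq (`|adjoint f y|) 0; first exact: normr_ge0.
rewrite -(@ler_pM2l _ `|adjoint f y|) ?lt_def ?y0//= -expr2 -dotpE -adjointP.
rewrite -[leLHS]ger0_norm; last by rewrite adjointP dnorm_ge0.
by apply: (le_trans (dotp_bound _ _)); rewrite ler_wpM2r.
Qed.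

(** The equality case of contractivity: |adjoint f (f x) - x|^2 expands to
    |adjoint f (f x)|^2 + |x|^2 - 2 |f x|^2, where both squares are at most
    |f x|^2. *)
Lemma adjoint_fixed f x : (forall x, `|f x| <= `|x|) ->
  `|x| <= `|f x| -> adjoint f (f x) = x.
Proof.
move=> f1 xfx; apply/eqP; rewrite -subr_eq0 -(dnorm_eq0 dotp) eq_le dnorm_ge0.
rewrite andbT dnormB/= (adjoint_dotp f x) geC0_conj ?dnorm_ge0// subr_le0.
by apply: lerD; rewrite -ler_norm_dotp// adjoint_contraction.
Qed.

(** Recognizes a partial isometry without knowing its adjoint. *)
Lemma partial_isometry_of_contractions f (g : K -> H) :
  (forall x, `|f x| <= `|x|) -> (forall y, `|g y| <= `|y|) ->
  (forall x, f (g (f x)) = f x) -> partial_isometry f.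
Proof.
move=> f1 g1 fgf; rewrite /partial_isometry; apply/funext => x /=.
by rewrite -{1}(fgf x) adjoint_fixed ?fgf.
Qed.

Lemma unitary_norm f x : unitary f -> `|f x| = `|x|.
Proof.
move=> [fK _]; apply/eqP; rewrite -(eqrXn2 (n := 2)) // -!dotpE adjointP.
by rewrite -[adjoint f (f x)]/((adjoint f \o f) x) fK.
Qed.

Lemma unitary_adjoint f : unitary f -> unitary (adjoint f).
Proof. by move=> [fK Kf]; split; rewrite adjointK. Qed.

End Adjoint.

(** * The converse of a partial injection *)

Section L2Converse.
Context {R : realType} {X Y : choiceType} (f : pinj X Y).

Lemma pinj_preim_inj y y' x :
  pinj_preim f y = Some x -> pinj_preim f y' = Some x -> y = y'.
Proof. by move=> /pinj_preimP fx /pinj_preimP; rewrite fx => -[]. Qed.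

Definition pinj_conv : pinj Y X := PInj pinj_preim_inj.

Lemma l2mapK (phi : l2 R X) :
  l2map f (l2map pinj_conv (l2map f phi)) = l2map f phi.
Proof.
apply: l2_ext => y.
have [[x fx]|fN] := pselect (exists x, f x = Some y); last first.
  by rewrite !l2map_out// => x fx; apply: fN; exists x.
rewrite (l2mapE _ fx).
have /(l2mapE (f := pinj_conv)) -> // : pinj_conv y = Some x.
exact/pinj_preimP.
Qed.

End L2Converse.

(** * Coefficients in an orthonormal family *)

Section Orthonormal.
Local Open Scope ring_scope.
Context {R : realType} {H : hilbertType R} {X : choiceType} (e : X -> H).

Definition orthonormal := forall j k, dotp (e j) (e k) = (j == k)%:R.

(** In a complete space this is the same as density of the span, and it is the
    form in which Zorn's lemma produces a basis. *)
Definition total_family := forall x, (forall k, dotp x (e k) = 0) -> x = 0.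

Hypothesis orth_e : orthonormal.

(** With p the projection of x on the span of A and s the sum of squares,
    <x|p> = <p|p> = s, so that 0 <= |x - p|^2 = |x|^2 - s. *)
Lemma bessel x (A : {fset X}) :
  \sum_(k <- A) normc (dotp x (e k)) ^+ 2 <= rnorm x ^+ 2.
Proof.
pose p := \sum_(k <- A) dotp x (e k) *: e k.
pose s := \sum_(k <- A) normc (dotp x (e k)) ^+ 2.
have dotp_p z : (forall k, k \in A -> dotp z (e k) = dotp x (e k)) ->
    dotp z p = (s%:C)%C.
  (* Both x and p have the coefficients of x along A. *)
  move=> zx; rewrite linear_sumr rmorph_sum; apply: eq_big_seq => k kA /=.
  by rewrite sqr_normcC linearZr_LR/= zx// mulrC.
have xp : dotp x p = (s%:C)%C by exact: dotp_p.
have pp : dotp p p = (s%:C)%C.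
  apply: dotp_p => k kA; rewrite dotpC linear_sumr (big_fsetD1 k)//= big1_fset.
    by rewrite addr0 linearZr_LR/= orth_e eqxx mulr1 conjCK.
  move=> j; rewrite !inE => /andP[jk _] _.
  by rewrite linearZr_LR/= orth_e eq_sym (negbTE jk) mulr0.
have := dnorm_ge0 dotp (x - p).
rewrite dnormB xp pp dotpE rnormE -rmorphXn.
rewrite (geC0_conj _); last by rewrite -pp dnorm_ge0.
by rewrite opprD addrACA subrr addr0 -rmorphB ler0c subr_ge0.
Qed.

Lemma coefficients_square_summable x :
  square_summable_pred (fun k => dotp x (e k)).
Proof.
by apply/asboolP/square_summableP; exists (rnorm x ^+ 2); exact: bessel.
Qed.

Definition coefficients x : l2 R X := L2 (coefficients_square_summable x).

Lemma coefficients_linear : linear coefficients.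
Proof.
move=> a x y; apply: l2_ext => k.
by rewrite l2DE l2ZE /= linearDl/= linearZl_LR.
Qed.

HB.instance Definition _ :=
  GRing.isLinear.Build R[i] H (l2 R X) *:%R coefficients coefficients_linear.

Lemma coefficients_norm_le x : `|coefficients x| <= `|x|.
Proof.
rewrite [leRHS]rnormE; apply: l2norm_bound; first exact: rnorm_ge0.
exact: bessel.
Qed.

Lemma coefficients_continuous : continuous coefficients.
Proof.
apply/linear_bounded_continuous/linear_boundedP.
exists 1; split; first exact: real1.
move=> r /ltW r1 x; apply: (le_trans (coefficients_norm_le x)).
by rewrite ler_peMl.
Qed.

HB.instance Definition _ :=
  isContinuous.Build H (l2 R X) coefficients coefficients_continuous.

(** By orthonormality the coefficients of e_k form the k-th unit vector of l2,
    so the net of partial sums is constant from [fset k] on. *)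
Lemma dotp_coefficients k (phi : l2 R X) :
  dotp (coefficients (e k)) phi = (phi k)^*%R.
Proof.
apply: l2dot_unique; apply: cvg_near_cst; exists [fset k]%fset => // A /= kA.
rewrite partial_sumE (big_fsetD1 k) ?(fsubsetP kA) ?inE//= big1_fset.
  by rewrite addr0 orth_e eqxx mul1r.
move=> j; rewrite !inE => /andP[jk _] _.
by rewrite orth_e eq_sym (negbTE jk) mul0r.
Qed.

(** A Riesz-Fischer theorem: the adjoint synthesizes a vector with prescribed
    coefficients.  It holds coordinatewise because pairing with e_k passes to
    pairing with the k-th unit vector of l2. *)
Lemma coefficients_adjointK (phi : l2 R X) :
  coefficients (adjoint coefficients phi) = phi.
Proof.
apply: l2_ext => k /=.
by rewrite adjoint_dotp dotpC dotp_coefficients conjCK.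
Qed.

Hypothesis total_e : total_family.

Lemma coefficients_inj : injective coefficients.
Proof.
move=> x y xy; apply/eqP; rewrite -subr_eq0; apply/eqP/total_e => k.
rewrite linearBl/=; apply/eqP; rewrite subr_eq0; apply/eqP.
by have := congr1 (fun phi : l2 R X => phi k) xy.
Qed.

Lemma coefficients_unitary : unitary (coefficients : {hilb H -> l2 R X}).
Proof.
split; apply/funext => x /=; last exact: coefficients_adjointK.
by apply: coefficients_inj; rewrite coefficients_adjointK.
Qed.

End Orthonormal.

(** * Maximal orthonormal sets *)

Section OrthonormalSets.
Local Open Scope ring_scope.
Local Open Scope classical_set_scope.
Context {R : realType} {H : hilbertType R}.
Implicit Types (S P E : set H).

Definition orthonormal_set E :=
  forall x y, E x -> E y -> dotp x y = (x == y)%:R.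

(** Maximality only forbids new vectors taken from P, so the conclusion is
    totality tested on P alone.  Two uses are made of it: a basis confined to P
    (S empty), and a basis extending S (P everything). *)
Lemma orthonormal_extension S P : orthonormal_set S ->
  (forall a x, P x -> P (a *: x)) ->
  exists E, [/\ S `<=` E, E `<=` S `|` P, orthonormal_set E &
    forall x, P x -> (forall y, E y -> dotp x y = 0) -> x = 0].
Proof.
move=> orthS PZ.
(* The added vectors A, rather than S `|` A, are ordered by inclusion: thus the
   empty chain, whose union is empty, needs no separate case. *)
pose Q := [set A | A `<=` P /\ orthonormal_set (S `|` A)].
have [F FQ totF|A [[AP orthA] maxA]] := @Zorn_bigcup _ Q.
  split; first by move=> x [A /FQ[AP _]]; exact: AP.
  move=> x y [Sx|[A FA Ax]] [Sy|[B FB By]].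
  - exact: orthS.
  - by have [_] := FQ _ FB; apply; [left|right].
  - by have [_] := FQ _ FA; apply; [right|left].
  - have [AB|BA] := totF _ _ FA FB.
      by have [_] := FQ _ FB; apply; right => //; exact: AB.
    by have [_] := FQ _ FA; apply; right => //; exact: BA.
exists (S `|` A); split=> //.
  by move=> x [Sx|/AP Px]; [left|right].
move=> x Px xA; apply: contrapT => /eqP x0.
pose z := `|x|^-1 *: x.
have zA y : (S `|` A) y -> dotp z y = 0.
  by move=> /xA xy; rewrite linearZl_LR/= xy mulr0.
have zz : dotp z z = 1.
  by rewrite dotpE normrZ normfV normr_id mulVf ?normr_eq0// expr1n.
have zNA : ~ (S `|` A) z.
  by move=> /zA; rewrite zz => /eqP; rewrite oner_eq0.
apply: (maxA (A `|` [set z])).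
  split; first by move=> y; left.
  by move=> /(_ z (or_intror erefl)) Az; apply: zNA; right.
split; first by move=> y [/AP//|->]; exact: PZ.
rewrite setUA => y t [Ay|->] [At|->]; first exact: orthA.
- rewrite dotp_eq0C ?zA//; case: eqP => // yz; case: zNA; by rewrite -yz.
- rewrite zA//; case: eqP => // zt; case: zNA; by rewrite zt.
- by rewrite eqxx.
Qed.

Lemma orthonormal_set_val E : orthonormal_set E ->
  orthonormal (fun k : E => val k).
Proof. by move=> orthE j k; rewrite orthE//; exact: set_valP. Qed.

End OrthonormalSets.

(** * Bases adapted to a partial isometry *)

Section Factorization.
Local Open Scope ring_scope.
Local Open Scope classical_set_scope.
Context {R : realType} {H K : hilbertType R} (i : {hilb H -> K}).
Definition adapted : set H := [set x | i x = 0 \/ adjoint i (i x) = x].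

Hypothesis pi_i : partial_isometry i.

Lemma partial_isometry_adjointK x : i (adjoint i (i x)) = i x.
Proof. exact: (congr1 (fun f => f x) pi_i). Qed.

(** Let E be maximal among the orthonormal sets of adapted vectors, and x
    orthogonal to E.  With p = adjoint i o i, the vectors p x (fixed by p) and
    then x (killed by i once p x = 0) are adapted.  Both are orthogonal to E,
    since p is self-adjoint and sends each vector of E to itself or to 0.
    Hence both vanish. *)
Lemma adapted_basis : exists E : set H, [/\ E `<=` adapted, orthonormal_set E &
  total_family (fun k : E => val k)].
Proof.
have [||E [_ EP orthE maxE]] := @orthonormal_extension R H set0 adapted.
- by move=> x y [].
- by move=> a x [ix|ix]; [left|right]; rewrite !linearZ/= ix ?scaler0.
exists E; split=> //; first by move=> x /EP [].
move=> x xE; have {}xE y : E y -> dotp x y = 0.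
  by move=> Ey; have := xE (SigSub (mem_set Ey)).
pose p z := adjoint i (i z).
have px0 : p x = 0.
  apply: maxE; first by right; rewrite /p partial_isometry_adjointK.
  move=> y Ey; rewrite /p adjoint_dotp adjointP.
  have [[]|[iy|->]] := EP y Ey; last exact: xE.
  by rewrite iy !linear0.
apply: maxE => //; left.
by rewrite -partial_isometry_adjointK -/(p x) px0 linear0.
Qed.

(** On vectors fixed by adjoint i o i, the map i preserves inner products. *)
Lemma image_basis (E : set H) : E `<=` adapted -> orthonormal_set E ->
  exists F : set K, [/\ forall x, E x -> i x != 0 -> F (i x),
    orthonormal_set F & total_family (fun k : F => val k)].
Proof.
move=> EP orthE.
pose S := [set y | exists x, [/\ E x, i x != 0 & y = i x]].
have [||F [SF _ orthF maxF]] := @orthonormal_extension R K S setT.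
- move=> _ _ [x [Ex ix ->]] [y [Ey iy ->]].
  have fixE z : E z -> i z != 0 -> adjoint i (i z) = z.
    by move=> /EP [->|//]; rewrite eqxx.
  rewrite adjointP fixE// orthE//; congr (nat_of_bool _)%:R.
  apply/eqP/eqP => [->//|xy]; by rewrite -(fixE _ Ex ix) xy fixE.
- by [].
exists F; split=> //.
  by move=> x Ex ix; apply: SF; exists x.
move=> x xF; apply: maxF => // y Fy.
exact: (xF (SigSub (mem_set Fy))).
Qed.

Section Matching.
Variables (E : set H) (F : set K).
Hypotheses (EP : E `<=` adapted) (EF : forall x, E x -> i x != 0 -> F (i x)).

Definition basis_match_fun (x : E) : option F :=
  if pselect (i (val x) = 0) is right ix then
    Some (SigSub (mem_set (EF (set_valP x) (introN eqP ix))))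
  else None.

Lemma basis_match_funP x y :
  basis_match_fun x = Some y <-> i (val x) = val y /\ i (val x) != 0.
Proof.
rewrite /basis_match_fun; case: pselect => [ix|ix]; last first.
  split=> [[<-]|[ixy _]]; first by split=> //; exact/eqP.
  by congr Some; exact/val_inj.
by split=> // -[_]; rewrite ix eqxx.
Qed.

(** A matched x is recovered from its image, as x = adjoint i (i x). *)
Lemma basis_match_inj x x' y :
  basis_match_fun x = Some y -> basis_match_fun x' = Some y -> x = x'.
Proof.
move=> /basis_match_funP[xy ix] /basis_match_funP[x'y ix'].
apply: val_inj => /=.
have [/eqP|<-] := EP (set_valP x); first by rewrite (negbTE ix).
have [/eqP|<-] := EP (set_valP x'); first by rewrite (negbTE ix').
by rewrite xy x'y.
Qed.

Definition basis_match : pinj E F := PInj basis_match_inj.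

Hypotheses (orthE : orthonormal_set E) (orthF : orthonormal_set F).
Hypothesis totalE : total_family (fun k : E => val k).

(** The coefficient of i x at y is <adjoint i y|x>.  If y = i k with k in E then
    adjoint i y = k.  If y is not in the image of the matching, it is orthogonal
    to every i k, so adjoint i y is orthogonal to E and vanishes by totality. *)
Lemma coefficients_match (x : H) :
  coefficients (orthonormal_set_val orthF) (i x) =
  l2map basis_match (coefficients (orthonormal_set_val orthE) x).
Proof.
apply: l2_ext => y.
have [[k ky]|kN] := pselect (exists k, basis_match k = Some y).
  rewrite (l2mapE _ ky) /=; have /basis_match_funP[iky ik] := ky.
  rewrite adjointP -iky; congr (dotp _ _).
  by have [/eqP|//] := EP (set_valP k); rewrite (negbTE ik).
rewrite l2map_out; last by move=> k ky; apply: kN; exists k.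
rewrite /= adjointP (_ : adjoint i (val y) = 0) ?linear0r//.
apply: totalE => k; rewrite adjoint_dotp.
have [->|ik] := eqVneq (i (val k)) 0; first by rewrite linear0r.
have Fik := EF (set_valP k) ik.
rewrite orthF//; last exact: set_valP.
case: eqP => // yik; case: kN; exists k; apply/basis_match_funP.
by rewrite yik.
Qed.

End Matching.

End Factorization.

Theorem proposition5p3 (R : realType) (H K : hilbertType R)
    (i : {hilb H -> K}) :
  partial_isometry i <->
  exists (X Y : choiceType) (f : pinj X Y)
    (u : {hilb H -> l2 R X}) (v : {hilb l2 R Y -> K}),
    [/\ unitary u, unitary v & i = v \o l2map f \o u :> (H -> K)].
Proof.
split=> [pi_i|[X [Y [f [u [v [uU vU iE]]]]]]]; last first.
  have iE' x : i x = v (l2map f (u x)) by rewrite iE.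
  have [[uK Ku] [vK Kv]] := (uU, vU).
  apply: (@partial_isometry_of_contractions _ _ _ _
    (fun y => adjoint u (l2map (pinj_conv f) (adjoint v y)))).
  - move=> x; rewrite iE' (unitary_norm _ vU).
    by rewrite -(unitary_norm x uU) l2map_norm_le.
  - move=> y; rewrite (unitary_norm _ (unitary_adjoint uU)).
    rewrite -(unitary_norm y (unitary_adjoint vU)).
    exact: l2map_norm_le.
  - move=> x; rewrite !iE'.
    rewrite -[adjoint v (v _)]/((adjoint v \o v) _) vK /=.
    by rewrite -[u (adjoint u _)]/((u \o adjoint u) _) Ku /= l2mapK.
have [E [EP orthE totalE]] := adapted_basis pi_i.
have [F [EF orthF totalF]] := image_basis EP orthE.
have uU := coefficients_unitary (orthonormal_set_val orthE) totalE.
have wU := coefficients_unitary (orthonormal_set_val orthF) totalF.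
exists E, F, (basis_match EP EF).
exists (coefficients (orthonormal_set_val orthE)).
exists (adjoint (coefficients (orthonormal_set_val orthF))).
split=> //; first exact: unitary_adjoint.
apply/funext => x /=.
rewrite -(coefficients_match EP EF orthE orthF totalE).
have [wK _] := wU.
by rewrite -[RHS]/((adjoint _ \o coefficients _) (i x)) wK.
Qed.
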